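(* The degree and residue of the pole are the only formal invariants of irregular singularities: let $d\ge 2$ be an integer and $\mathrm{res}\in\mathbb{C}$, and let $p_1\in X_1$, $p_2\in X_2$ be points of two Riemann surfaces endowed with meromorphic connections $\nabla_1,\nabla_2$, such that each $p_j$ is a pole of $\nabla_j$ of order $d$ and residue $\mathrm{res}$. Then for any two Riemann charts sending respectively $p_1$ and $p_2$ to $0\in\mathbb{C}$, the Christoffel symbols $\Gamma_1$ and $\Gamma_2$ of $\nabla_1$ and $\nabla_2$ in these charts are formally equivalent.
   Context: A meromorphic connection $\nabla$ on (the tangent bundle of) a Riemann surface $X$ is given in each holomorphic chart $R$ of $X$ (a Riemann chart) by a meromorphic function $\Gamma_R$, its Christoffel symbol, such that for two charts $R_1,R_2$ with change of charts $\psi=R_2\circ R_1^{-1}$ one has $\Gamma_1=\psi'\cdot(\Gamma_2\circ\psi)+\psi''/\psi'$. Being a pole, the order of the pole and the residue do not depend on the chart. The residue $\mathrm{res}$ of $\nabla$ at a pole is by convention the residue of $-\Gamma$. An irregular singularity is a pole of order (degree) at least $2$. Formal equivalence: for a germ at $0$ of meromorphic function $\Gamma$ (or a formal Laurent series in $\mathbb{C}((X))$) and a formal power series $\Phi=a_1X+\sum_{n\ge2}a_nX^n\in\mathbb{C}[[X]]$ with $a_1\ne0$, put $\Phi^*\Gamma:=\Phi'\cdot(\Gamma\circ\Phi)+\Phi''/\Phi'\in\mathbb{C}((X))$. Then $\Gamma_1$ and $\Gamma_2$ are formally equivalent if there is such a $\Phi$ with $\Gamma_1=\Phi^*\Gamma_2$.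 *)

(* Defs.v *)
From HB Require Import structures.
From mathcomp Require Import all_boot all_order all_algebra.
From mathcomp Require Import complex.
From mathcomp Require Import all_classical all_reals all_analysis.
Set Implicit Arguments.
Unset Strict Implicit.
Unset Printing Implicit Defensive.
Import Order.TTheory GRing.Theory Num.Theory numFieldNormedType.Exports.

Local Open Scope classical_set_scope.
Local Open Scope ring_scope.
Local Open Scope complex_scope.

(* The elements of K((X)) are the coefficient functions int -> K whose support
   is bounded below.  The sums over [set: int] below are finitely supported
   sums: for such functions only finitely many of their terms are nonzero. *)

Definition is_laurent (K : fieldType) (a : int -> K) : Prop :=
  exists N : int, forall n : int, n < N -> a n = 0.

Definition laurent_one (K : fieldType) : int -> K :=
  fun n => (n == 0)%:R.

Definition laurent_add (K : fieldType) (a b : int -> K) : int -> K :=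
  fun n => a n + b n.

Definition laurent_mul (K : fieldType) (a b : int -> K) : int -> K :=
  fun n => \sum_(k \in [set: int]) a k * b (n - k).

(* K((X)) is a field, so the inverse of a nonzero series exists and is
   unique; the default value 0 is only taken when there is none. *)
Definition laurent_inv (K : fieldType) (a : int -> K) : int -> K :=
  xget (fun=> 0)
    [set b : int -> K | is_laurent b /\ laurent_mul a b = laurent_one K].

Definition laurent_exp (K : fieldType) (a : int -> K) (n : int) : int -> K :=
  match n with
  | Posz m => iter m (laurent_mul a) (laurent_one K)
  | Negz m => iter m.+1 (laurent_mul (laurent_inv a)) (laurent_one K)
  end.

Definition laurent_deriv (K : fieldType) (a : int -> K) : int -> K :=
  fun n => (n + 1)%:~R * a (n + 1).

(* a \o b = \sum_k a_k b^k, for b without constant or polar term; b^k then has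
   order at least k, so that each coefficient is a finite sum. *)
Definition laurent_comp (K : fieldType) (a b : int -> K) : int -> K :=
  fun n => \sum_(k \in [set: int]) a k * laurent_exp b k n.

Definition laurent_of_series (K : fieldType) (a : nat -> K) : int -> K :=
  fun n => if n is Posz m then a m else 0.

Definition formal_pullback (K : fieldType) (Phi : nat -> K) (g : int -> K) :
    int -> K :=
  let phi := laurent_of_series Phi in
  let phi' := laurent_deriv phi in
  let phi'' := laurent_deriv phi' in
  laurent_add (laurent_mul phi' (laurent_comp g phi))
              (laurent_mul phi'' (laurent_inv phi')).

Definition formally_equivalent (K : fieldType) (g1 g2 : int -> K) : Prop :=
  exists Phi : nat -> K,
    [/\ Phi 0%N = 0, Phi 1%N != 0 & g1 = formal_pullback Phi g2].

(* The complex plane, with its normed topology. *)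
Notation Cplane R := ((R[i])^o).

Definition holomorphic_on (R : realType) (U : set (Cplane R))
    (f : Cplane R -> Cplane R) : Prop :=
  forall z, U z -> derivable f z 1.

(* Meromorphic functions are represented by total functions whose values on a
   discrete set (in particular at the poles) are irrelevant: only the values on
   punctured neighbourhoods of points are ever used. *)
Definition laurent_expansion (R : realType) (f : Cplane R -> Cplane R)
    (p : Cplane R) (c : int -> R[i]) : Prop :=
  exists N : nat,
    (forall n : int, n < - (N%:Z) -> c n = 0) /\
    \forall z \near p^',
      series (fun k : nat => (c (k%:Z - N%:Z) * (z - p) ^ (k%:Z - N%:Z))
                               : Cplane R) @ \oo --> f z.

Definition meromorphic_on (R : realType) (U : set (Cplane R))
    (f : Cplane R -> Cplane R) : Prop :=
  forall p, U p -> exists c, laurent_expansion f p c.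

Definition has_pole_of_order (R : realType) (f : Cplane R -> Cplane R)
    (p : Cplane R) (d : nat) : Prop :=
  (0 < d)%N /\
  exists c, [/\ laurent_expansion f p c,
                c (- (d%:Z)) != 0
              & forall n : int, n < - (d%:Z) -> c n = 0].

Definition has_residue (R : realType) (f : Cplane R -> Cplane R)
    (p : Cplane R) (r : R[i]) : Prop :=
  exists c, laurent_expansion f p c /\ c (- 1) = r.

Definition formally_equivalent_germs (R : realType)
    (f1 f2 : Cplane R -> Cplane R) : Prop :=
  exists g1 g2 : int -> R[i],
    [/\ laurent_expansion f1 0 g1, laurent_expansion f2 0 g2
      & formally_equivalent g1 g2].

(* A homeomorphism from an open subset of T onto an open subset of the plane,
   given with its inverse; the values of chart_fun and chart_inv outside of
   these sets are irrelevant. *)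
Record chart (R : realType) (T : topologicalType) := Chart {
  chart_dom : set T;
  chart_cod : set (Cplane R);
  chart_fun :> T -> Cplane R;
  chart_inv : Cplane R -> T;
  chart_dom_open : open chart_dom;
  chart_cod_open : open chart_cod;
  chart_funS : forall x, chart_dom x -> chart_cod (chart_fun x);
  chart_invS : forall z, chart_cod z -> chart_dom (chart_inv z);
  chart_funK : forall x, chart_dom x -> chart_inv (chart_fun x) = x;
  chart_invK : forall z, chart_cod z -> chart_fun (chart_inv z) = z;
  chart_fun_continuous : forall x, chart_dom x -> {for x, continuous chart_fun};
  chart_inv_continuous : forall z, chart_cod z -> {for z, continuous chart_inv}
}.

Definition change_of_charts (R : realType) (T : topologicalType)
    (R1 R2 : chart R T) : Cplane R -> Cplane R :=
  R2 \o chart_inv R1.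

(* R1(U1 `&` U2), where the domain of Rj is Uj *)
Definition change_dom (R : realType) (T : topologicalType)
    (R1 R2 : chart R T) : set (Cplane R) :=
  [set z | chart_cod R1 z /\ chart_dom R2 (chart_inv R1 z)].

Definition compatible_charts (R : realType) (T : topologicalType)
    (R1 R2 : chart R T) : Prop :=
  holomorphic_on (change_dom R1 R2) (change_of_charts R1 R2) /\
  holomorphic_on (change_dom R2 R1) (change_of_charts R2 R1).

Record riemannSurface (R : realType) := RiemannSurface {
  rs_space :> topologicalType;
  rs_hausdorff : hausdorff_space rs_space;
  rs_connected : connected [set: rs_space];
  rs_atlas : set (chart R rs_space);
  rs_atlas_cover : forall x : rs_space,
    exists2 R1, rs_atlas R1 & chart_dom R1 x;
  rs_atlas_compatible : forall R1 R2,
    rs_atlas R1 -> rs_atlas R2 -> compatible_charts R1 R2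
}.

(* The charts of the maximal atlas. *)
Definition riemann_chart (R : realType) (X : riemannSurface R)
    (R1 : chart R X) : Prop :=
  forall R2, rs_atlas R2 -> compatible_charts R1 R2.

(* The transformation law is an equality of meromorphic functions, hence is
   required on a punctured neighbourhood of each point of R1(U1 `&` U2). *)
Record meromorphicConnection (R : realType) (X : riemannSurface R) :=
    MeromorphicConnection {
  christoffel : chart R X -> Cplane R -> Cplane R;
  christoffel_meromorphic : forall R1, riemann_chart R1 ->
    meromorphic_on (chart_cod R1) (christoffel R1);
  christoffel_change : forall R1 R2, riemann_chart R1 -> riemann_chart R2 ->
    let psi := change_of_charts R1 R2 in
    forall z0, change_dom R1 R2 z0 -> \forall z \near z0^',
      christoffel R1 z = derive1 psi z * christoffel R2 (psi z)
                         + derive1 (derive1 psi) z / derive1 psi z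
}.

(* The order of a pole and the residue do not depend on the chart: they are
   those read in the Riemann charts around p. *)
Definition connection_pole (R : realType) (X : riemannSurface R)
    (nabla : meromorphicConnection X) (p : X) (d : nat) : Prop :=
  forall R1 : chart R X, riemann_chart R1 -> chart_dom R1 p ->
    has_pole_of_order (christoffel nabla R1) (R1 p) d.

(* The sign is a convention: the residue of nabla is that of - Gamma. *)
Definition connection_residue (R : realType) (X : riemannSurface R)
    (nabla : meromorphicConnection X) (p : X) (r : R[i]) : Prop :=
  forall R1 : chart R X, riemann_chart R1 -> chart_dom R1 p ->
    has_residue (fun z => - christoffel nabla R1 z) (R1 p) r.

(* Main.v *)
(* Write Gamma_j = c_j X^(-d) + ..., with c_j != 0, and look for
   Phi = a_1 X + a_2 X^2 + ...  The coefficient of X^(-d) in Phi^* Gamma_2 is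
   c_2 a_1^(1 - d), which fixes a_1 since d > 1.  For n >= 2, changing a_n by e
   leaves the coefficients of Phi^* Gamma_2 below X^(n - 1 - d) unchanged and
   adds (n - d) c_2 a_1^(-d) e to that of X^(n - 1 - d); the term Phi'' / Phi'
   only changes from X^(n - 2) on, which is further since d > 1.  So the a_n
   can be determined one after the other, except for n = d, where nothing has
   to be done: the coefficient of X^(-1) in Phi^* Gamma_2 is always the one of
   Gamma_2, because residues are invariant under formal changes of variable.
   The Laurent coefficients of a germ are well defined by the identity
   theorem. *)
Require Import Defs.
From HB Require Import structures.
From mathcomp Require Import all_boot all_order all_algebra.
From mathcomp Require Import complex.
From mathcomp Require Import all_classical all_reals all_analysis.
From mathcomp Require Import zify ring.
Set Implicit Arguments.
Unset Strict Implicit.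
Unset Printing Implicit Defensive.
Import Order.TTheory GRing.Theory Num.Theory numFieldNormedType.Exports.
Local Open Scope ring_scope.
Local Open Scope complex_scope.

(** * Finite windows of integers *)

Definition int_range (s : int) (L : nat) : seq int :=
  [seq s + i%:Z | i <- iota 0 L].

Lemma mem_int_range s L k : (k \in int_range s L) = (s <= k < s + L%:Z).
Proof.
apply/mapP/idP => [[j]|/andP[sk kL]]; first by rewrite mem_iota => + ->; lia.
by exists `|k - s|%N; [rewrite mem_iota; lia|lia].
Qed.

Lemma int_range_uniq s L : uniq (int_range s L).
Proof. by rewrite map_inj_uniq ?iota_uniq// => i j /addrI[]. Qed.

(** * Products of coefficient functions with support bounded below *)

Section LaurentCoefficients.
Variable K : fieldType.
Implicit Types a b c : int -> K.

Definition vanishes_below (s : int) a := forall n, n < s -> a n = 0.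

Lemma fsbig_int_range (F : int -> K) s L :
  (forall k, ~~ (s <= k < s + L%:Z) -> F k = 0) ->
  \sum_(k \in [set: int]) F k = \sum_(k <- int_range s L) F k.
Proof.
move=> F0; rewrite (@fsbigE _ _ _ _ _ (int_range s L)) ?int_range_uniq//.
- by apply: eq_bigl => k; rewrite in_setT.
- by move=> k _; rewrite mem_int_range => /F0.
Qed.

(** Terms with [k < s] or [n - k < t] are zero, so a window that starts at [r <= s] and reaches past
    [n - t] carries the whole sum. Leaving [r] and [L] free lets several products share one
    window. *)
Lemma laurent_mulE a b s t n r L : vanishes_below s a -> vanishes_below t b ->
    r <= s -> n - t < r + L%:Z ->
  laurent_mul a b n = \sum_(k <- int_range r L) a k * b (n - k).
Proof.
move=> va vb rs nL; apply: fsbig_int_range => k kN.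
have [ks|ks] := ltP k s; first by rewrite va ?mul0r.
by rewrite vb ?mulr0//; lia.
Qed.

Lemma laurent_mul_vanishes a b s t :
  vanishes_below s a -> vanishes_below t b ->
  vanishes_below (s + t) (laurent_mul a b).
Proof.
move=> va vb n nst; rewrite (laurent_mulE (L := 0) va vb (lexx s)); last lia.
by rewrite big_nil.
Qed.

Lemma laurent_mul_lead a b s t :
  vanishes_below s a -> vanishes_below t b ->
  laurent_mul a b (s + t) = a s * b t.
Proof.
move=> va vb; rewrite (laurent_mulE (L := 1) va vb (lexx s)); last lia.
by rewrite big_seq1 addr0 addrAC subrr add0r.
Qed.

Lemma laurent_mulC a b : laurent_mul a b = laurent_mul b a.
Proof.
apply/funext => n; rewrite /laurent_mul (reindex_fsbigT (fun k => n - k)) /=.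
  by apply: eq_fsbigr => k _; rewrite opprB addrCA subrr addr0 mulrC.
by exists (fun k => n - k) => k; lia.
Qed.

(** Over one window large enough for both sides this is an exchange of finite sums, [i] being the
    total exponent taken from [a] and [b]. *)
Lemma laurent_mulA a b c s t u :
  vanishes_below s a -> vanishes_below t b -> vanishes_below u c ->
  laurent_mul a (laurent_mul b c) = laurent_mul (laurent_mul a b) c.
Proof.
move=> va vb vc; apply/funext => n.
(* The outer index runs from [s] to [n - u - t] on the left side and from [s + t] to [n - u] on the
   right; [r] and [h] bound both ranges. *)
pose r : int := Num.min s (s + t).
pose h : int := Num.max (n - u - t) (n - u).
pose L := absz (Num.max 0 (h + 1 - r)).
have [rs rt hu hut] : [/\ r <= s, r <= s + t, n - u - t <= h & n - u <= h].
  by rewrite /r /h; split; lia.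
have rL : h < r + L%:Z by rewrite /L; lia.
clearbody r h L.
rewrite (laurent_mulE (r := r) (L := L) va (laurent_mul_vanishes vb vc));
  [|lia|lia].
rewrite (laurent_mulE (r := r) (L := L) (laurent_mul_vanishes va vb) vc);
  [|lia|lia].
transitivity (\sum_(k <- int_range r L) \sum_(i <- int_range r L)
    a k * (b (i - k) * c (n - i))).
  apply: eq_bigr => k _; rewrite -mulr_sumr.
  have [ks|ks] := ltP k s; first by rewrite va ?mul0r.
  congr (_ * _); rewrite /laurent_mul.
  rewrite (reindex_fsbigT (fun i => i - k)) /=; last first.
    by exists (fun i => i + k) => i; lia.
  rewrite (@fsbig_int_range _ r L).
    by apply: eq_bigr => i _; congr (_ * c _); lia.
  move=> i iN; have [it|it] := ltP (i - k) t; first by rewrite vb ?mul0r.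
  by rewrite (vc (n - k - (i - k))) ?mulr0//; lia.
rewrite exchange_big /=; apply: eq_bigr => i _.
have [iu|iu] := ltP (n - i) u.
  by rewrite vc// mulr0 big1// => k _; rewrite !mulr0.
rewrite (laurent_mulE (r := r) (L := L) va vb); [|lia|lia].
by rewrite mulr_suml; apply: eq_bigr => k _; rewrite mulrA.
Qed.

Lemma laurent_mulDl a a' b s t :
  vanishes_below s a -> vanishes_below s a' -> vanishes_below t b ->
  laurent_mul (laurent_add a a') b =
  laurent_add (laurent_mul a b) (laurent_mul a' b).
Proof.
move=> va va' vb; apply/funext => n.
have vaa : vanishes_below s (laurent_add a a').
  by move=> k ks; rewrite /laurent_add va// va'// addr0.
pose L := absz (Num.max 0 (n - t - s + 1)).
have nL : n - t < s + L%:Z by rewrite /L; lia.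
rewrite /laurent_add !(laurent_mulE (L := L) _ vb (lexx s))//.
by rewrite -big_split; apply: eq_bigr => k _; rewrite mulrDl.
Qed.

Lemma laurent_mul1 a : laurent_mul (laurent_one K) a = a.
Proof.
apply/funext => n; rewrite /laurent_mul (@fsbig_int_range _ 0 1).
  by rewrite big_seq1 /laurent_one eqxx mul1r; congr (a _); lia.
by move=> k kN; rewrite /laurent_one (_ : k == 0 = false) ?mul0r//; lia.
Qed.

End LaurentCoefficients.

(** * The ring of formal Laurent series *)

(** Bundling the bound on the support gives a type with a ring structure, on which [ring] works. *)
Record laurent (K : fieldType) := Laurent {
  laurent_coef :> int -> K;
  laurent_coefP : is_laurent laurent_coef
}.

HB.instance Definition _ K := gen_eqMixin (laurent K).
HB.instance Definition _ K := gen_choiceMixin (laurent K).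

Lemma laurentP K (x y : laurent K) : (forall n, x n = y n) -> x = y.
Proof.
case: x y => [a aP] [b bP] /= /funext ab; case: _ / ab in bP *.
by congr Laurent; exact: Prop_irrelevance.
Qed.

Section LaurentRing.
Variable K : fieldType.
Implicit Types (x y z : laurent K) (s t n : int).

Lemma laurent_vanishes x y z :
  exists s, [/\ vanishes_below s x, vanishes_below s y & vanishes_below s z].
Proof.
have [[s xs] [t yt] [u zu]] :=
  And3 (laurent_coefP x) (laurent_coefP y) (laurent_coefP z).
exists (Num.min s (Num.min t u)).
by split=> n nl; [apply: xs|apply: yt|apply: zu]; lia.
Qed.

Fact is_laurent_monomial (c : K) s :
  is_laurent (fun n => if n == s then c else 0).
Proof. by exists s => n ns; case: eqP => [nEs|//]; lia. Qed.
Definition lmonomial c s := Laurent (is_laurent_monomial c s).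

Fact is_laurent_zero : is_laurent (fun=> 0 : K).
Proof. by exists 0. Qed.

Fact is_laurent_one : is_laurent (laurent_one K).
Proof. by exists 0 => n n0; rewrite /laurent_one (_ : n == 0 = false)//; lia. Qed.

Fact is_laurent_opp x : is_laurent (fun n => - x n).
Proof.
by have [s xs] := laurent_coefP x; exists s => n ns; rewrite xs ?oppr0.
Qed.

Fact is_laurent_add x y : is_laurent (laurent_add x y).
Proof.
have [s [xs ys _]] := laurent_vanishes x y y.
by exists s => n ns; rewrite /laurent_add xs// ys// addr0.
Qed.

Fact is_laurent_mul x y : is_laurent (laurent_mul x y).
Proof.
have [s [xs ys _]] := laurent_vanishes x y y.
by exists (s + s); exact: laurent_mul_vanishes.
Qed.

Fact laurent_ring_addA : associative (fun x y => Laurent (is_laurent_add x y)).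
Proof. by move=> x y z; apply: laurentP => n; exact: addrA. Qed.

Fact laurent_ring_addC : commutative (fun x y => Laurent (is_laurent_add x y)).
Proof. by move=> x y; apply: laurentP => n; exact: addrC. Qed.

Fact laurent_ring_add0 :
  left_id (Laurent is_laurent_zero) (fun x y => Laurent (is_laurent_add x y)).
Proof. by move=> x; apply: laurentP => n; exact: add0r. Qed.

Fact laurent_ring_addN :
  left_inverse (Laurent is_laurent_zero) (fun x => Laurent (is_laurent_opp x))
    (fun x y => Laurent (is_laurent_add x y)).
Proof. by move=> x; apply: laurentP => n; exact: addNr. Qed.

HB.instance Definition _ := GRing.isZmodule.Build (laurent K)
  laurent_ring_addA laurent_ring_addC laurent_ring_add0 laurent_ring_addN.

Fact laurent_ring_mulA : associative (fun x y => Laurent (is_laurent_mul x y)).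
Proof.
move=> x y z; apply: laurentP => n /=.
have [s [xs ys zs]] := laurent_vanishes x y z.
by rewrite (laurent_mulA xs ys zs).
Qed.

Fact laurent_ring_mulC : commutative (fun x y => Laurent (is_laurent_mul x y)).
Proof. by move=> x y; apply: laurentP => n /=; rewrite laurent_mulC. Qed.

Fact laurent_ring_mul1 :
  left_id (Laurent is_laurent_one) (fun x y => Laurent (is_laurent_mul x y)).
Proof. by move=> x; apply: laurentP => n /=; rewrite laurent_mul1. Qed.

Fact laurent_ring_mulDl :
  left_distributive (fun x y => Laurent (is_laurent_mul x y)) +%R.
Proof.
move=> x y z; apply: laurentP => n /=.
have [s [xs ys zs]] := laurent_vanishes x y z.
by rewrite (laurent_mulDl xs ys zs).
Qed.

Fact laurent_ring_one_neq0 : Laurent is_laurent_one != 0.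
Proof.
apply/eqP => /(congr1 (fun x : laurent K => x 0)).
by rewrite /= /laurent_one eqxx; apply/eqP; exact: oner_neq0.
Qed.

HB.instance Definition _ := GRing.Zmodule_isComNzRing.Build (laurent K)
  laurent_ring_mulA laurent_ring_mulC laurent_ring_mul1 laurent_ring_mulDl
  laurent_ring_one_neq0.

Lemma lcoef0 n : (0 : laurent K) n = 0. Proof. by []. Qed.
Lemma lcoefD x y n : (x + y) n = x n + y n. Proof. by []. Qed.
Lemma lcoefN x n : (- x) n = - x n. Proof. by []. Qed.
Lemma lcoefB x y n : (x - y) n = x n - y n. Proof. by []. Qed.
Lemma lcoef1 n : (1 : laurent K) n = (n == 0)%:R. Proof. by []. Qed.

Lemma vanishes_belowM x y s t : vanishes_below s x -> vanishes_below t y ->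
  vanishes_below (s + t) (x * y).
Proof. exact: laurent_mul_vanishes. Qed.

Lemma lcoefM_lead x y s t : vanishes_below s x -> vanishes_below t y ->
  (x * y) (s + t) = x s * y t.
Proof. exact: laurent_mul_lead. Qed.

Lemma vanishes_belowD x y s : vanishes_below s x -> vanishes_below s y ->
  vanishes_below s (x + y).
Proof. by move=> vx vy n ns; rewrite lcoefD vx// vy// addr0. Qed.

Lemma vanishes_belowN x s : vanishes_below s x -> vanishes_below s (- x).
Proof. by move=> vx n ns; rewrite lcoefN vx// oppr0. Qed.

Lemma vanishes_belowX x s k :
  vanishes_below s x -> vanishes_below (s *+ k) (x ^+ k).
Proof.
move=> vx; elim: k => [|k IHk].
  by rewrite mulr0n expr0 => n n0; rewrite lcoef1 (_ : n == 0 = false)//; lia.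
by rewrite exprS mulrS; exact: vanishes_belowM.
Qed.

Lemma lcoefX_lead x s k : vanishes_below s x -> (x ^+ k) (s *+ k) = x s ^+ k.
Proof.
move=> vx; elim: k => [|k IHk]; first by rewrite mulr0n expr0 lcoef1 eqxx.
by rewrite !exprS mulrS lcoefM_lead ?IHk//; exact: vanishes_belowX.
Qed.

(** The difference is [x - y] times a sum of [k + 1] monomials of degree [k] in [x] and [y], each of
    order at least [k s]; the induction peels off one factor at a time. *)
Lemma subX_vanishes x y s t k :
  vanishes_below s x -> vanishes_below s y -> vanishes_below t (x - y) ->
  vanishes_below (t + s *+ k) (x ^+ k.+1 - y ^+ k.+1).
Proof.
move=> vx vy vxy; elim: k => [|k IHk]; first by rewrite !expr1 mulr0n addr0.
rewrite (_ : _ - _ = x * (x ^+ k.+1 - y ^+ k.+1) + (x - y) * y ^+ k.+1);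
  last by rewrite (exprS x k.+1) (exprS y k.+1); ring.
apply: vanishes_belowD.
  by rewrite mulrS addrCA; exact: vanishes_belowM.
by apply: vanishes_belowM => //; exact: vanishes_belowX.
Qed.

(** Each of the [k + 1] monomials has the coefficient [x s ^+ k] at [s *+ k], because [x] and [y]
    agree at [s]. *)
Lemma subX_lead x y s t k :
  vanishes_below s x -> vanishes_below s y -> vanishes_below t (x - y) ->
  x s = y s ->
  (x ^+ k.+1 - y ^+ k.+1) (t + s *+ k) = k.+1%:R * x s ^+ k * (x - y) t.
Proof.
move=> vx vy vxy exy; elim: k => [|k IHk].
  by rewrite !expr1 mulr0n addr0 expr0 !mul1r.
rewrite (_ : _ - _ = x * (x ^+ k.+1 - y ^+ k.+1) + (x - y) * y ^+ k.+1);
  last by rewrite (exprS x k.+1) (exprS y k.+1); ring.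
rewrite [LHS]lcoefD {1}mulrS addrCA.
rewrite (lcoefM_lead vx (subX_vanishes (k := k) vx vy vxy)) IHk.
rewrite (lcoefM_lead vxy (vanishes_belowX (k := k.+1) vy)).
rewrite lcoefX_lead// -exy (exprS (x s) k) -(natr1 k.+1); ring.
Qed.

End LaurentRing.

(** * Triangular systems and inverses *)

Section LaurentField.
Variable K : fieldType.
Implicit Types (x y z : laurent K) (s t n : int).

(* Successive approximation: [F] is triangular, its [n]-th diagonal entry being
   [lam n]; where that entry vanishes the equation has to hold for free. *)
Lemma triangular_solve (F : laurent K -> int -> K) (x0 : laurent K)
    (g : int -> K) (s m : int) (lam : int -> K) :
  (forall x y n, s <= n -> vanishes_below s (x - x0) ->
     vanishes_below s (y - x0) -> vanishes_below n (x - y) ->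
     (forall k : int, k < n + m -> F x k = F y k) /\
     F x (n + m) - F y (n + m) = lam n * (x - y) n) ->
  (forall x n, s <= n -> vanishes_below s (x - x0) -> lam n = 0 ->
     F x (n + m) = g (n + m)) ->
  (forall k : int, k < s + m -> F x0 k = g k) ->
  exists2 x, vanishes_below s (x - x0) & F x = g.
Proof.
move=> Ftri Ffree F0.
(* The correction at index [s + j] that makes the equation hold at [s + j + m]. Where the diagonal
   entry is zero, division by zero returns 0 and nothing is changed. *)
pose c (j : nat) x := (g (s + j%:Z + m) - F x (s + j%:Z + m)) / lam (s + j%:Z).
pose T := fix T j :=
  if j is i.+1 then T i + lmonomial (c i (T i)) (s + i%:Z) else x0.
have TS i : T i.+1 = T i + lmonomial (c i (T i)) (s + i%:Z) by [].
have T0 : T 0%N = x0 by [].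
clearbody T.
have TT j i : vanishes_below (s + j%:Z) (T (j + i)%N - T j).
  elim: i => [|i IHi] n nj; first by rewrite addn0 subrr.
  rewrite addnS TS addrAC lcoefD IHi// add0r /=.
  by case: eqP => [nE|//]; lia.
have TD j : vanishes_below s (T j - x0) by rewrite -T0 -[s]addr0; exact: (TT 0 j).
have Tg j (k : int) : k < s + j%:Z + m -> F (T j) k = g k.
  elim: j k => [|j IHj] k kj; first by rewrite T0; apply: F0; lia.
  have Tj : vanishes_below (s + j%:Z) (T j.+1 - T j) by rewrite -addn1; exact: TT.
  have [below diag] := Ftri _ _ (s + j%:Z) ltac:(lia) (TD j.+1) (TD j) Tj.
  have [kj'|kj'] := ltP k (s + j%:Z + m); first by rewrite below// IHj.
  have -> : k = s + j%:Z + m by lia.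
  (* With a zero diagonal entry the equation holds for free; otherwise the increment of [F] is
     exactly the defect that [c j] was chosen to cancel. *)
  have [l0|l0] := eqVneq (lam (s + j%:Z)) 0; first by apply: Ffree => //; lia.
  apply/eqP; rewrite -subr_eq0; apply/eqP.
  transitivity (F (T j.+1) (s + j%:Z + m) - F (T j) (s + j%:Z + m)
    - (g (s + j%:Z + m) - F (T j) (s + j%:Z + m))); first by ring.
  rewrite diag (_ : (T j.+1 - T j) (s + j%:Z) = c j (T j)).
    by rewrite /c; field.
  by rewrite lcoefB TS lcoefD /= eqxx addrAC subrr add0r.
(* The coefficient at [s + i] is last altered in the passage to [T i.+1], so the limit reads it
   there; below [s] it stays that of [x0]. *)
have xP : is_laurent (fun n => if n < s then x0 n else T `|n - s|.+1 n).
  have [u [xu _ _]] := laurent_vanishes x0 x0 x0.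
  by exists (Num.min s u) => n nl; rewrite ifT ?xu//; lia.
pose x := Laurent xP.
have xT j : vanishes_below (s + j%:Z) (x - T j).
  move=> n nj; rewrite lcoefB /=; case: ltP => ns.
    by apply/eqP; rewrite -oppr_eq0 opprB; apply/eqP; exact: TD.
  have -> : j = (`|n - s|.+1 + (j - `|n - s|.+1))%N by lia.
  by apply/eqP; rewrite -oppr_eq0 opprB; apply/eqP; apply: TT; lia.
have xD : vanishes_below s (x - x0) by rewrite -T0 -[s]addr0; exact: (xT 0).
exists x => //; apply/funext => n.
pose j := `|(n - s - m)%R|.+1.
have [below _] := Ftri _ _ (s + j%:Z) ltac:(lia) xD (TD j) (xT j).
by rewrite below ?Tg//; lia.
Qed.

Fact is_laurent_inv x : is_laurent (laurent_inv x).
Proof.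
rewrite /laurent_inv; case: xgetP => [b -> []//|_].
by exists 0.
Qed.
Definition linv x := Laurent (is_laurent_inv x).

Section Inverse.
Variables (x : laurent K) (s : int).
Hypotheses (vx : vanishes_below s x) (xs0 : x s != 0).

(** Multiplication by [x] is triangular with constant diagonal entry [x s], so [x * y = 1] can be
    solved starting from 0. Inverses in a commutative ring being unique, the solution is the series
    that [xget] selects. *)
Lemma linv_spec : vanishes_below (- s) (linv x) /\ x * linv x = 1.
Proof.
have [y vy xy] : exists2 y : laurent K, vanishes_below (- s) (y - 0) &
    laurent_coef (x * y) = (1 : laurent K).
  apply: (@triangular_solve (fun y => laurent_coef (x * y)) 0
    (1 : laurent K) (- s) s (fun=> x s)).
  - move=> y z n _ _ _ vyz.
    have xyz k : (x * y) k - (x * z) k = (x * (y - z)) k.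
      by rewrite mulrBr.
    split=> [k kn|]; last by rewrite xyz [n + s]addrC (lcoefM_lead vx vyz).
    apply/eqP; rewrite -subr_eq0 xyz (vanishes_belowM vx vyz)//; lia.
  - by move=> y n _ _ xs; move: xs0; rewrite xs eqxx.
  - move=> k; rewrite addNr mulr0 => k0.
    by rewrite lcoef0 lcoef1 (_ : k == 0 = false)//; lia.
have {}xy : x * y = 1 by apply: laurentP => n; rewrite xy.
suff -> : linv x = y by rewrite subr0 in vy.
rewrite /linv; apply: laurentP => n /=; congr (_ n).
rewrite /laurent_inv; apply: xget_unique => /=.
  by split; [exact: laurent_coefP|exact: (congr1 (@laurent_coef K) xy)].
move=> b [bP xb]; pose z := Laurent bP.
have xz : x * z = 1 by apply: laurentP => k; exact: (congr1 (@^~ k) xb).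
have -> : b = z by [].
by congr laurent_coef; rewrite -[z]mul1r -xy mulrAC xz mul1r.
Qed.

Lemma linv_vanishes : vanishes_below (- s) (linv x).
Proof. by have [] := linv_spec. Qed.

Lemma mulx_linv : x * linv x = 1.
Proof. by have [] := linv_spec. Qed.

Lemma linv_lead : linv x (- s) = (x s)^-1.
Proof.
apply: (mulfI xs0); rewrite mulfV// -(lcoefM_lead vx linv_vanishes).
by rewrite mulx_linv subrr lcoef1 eqxx.
Qed.

End Inverse.

(** Follows from 1/x - 1/y = - (x - y) / (x y). *)
Lemma linvB x y s t : vanishes_below s x -> vanishes_below s y ->
    x s != 0 -> x s = y s -> vanishes_below t (x - y) ->
  vanishes_below (t - s - s) (linv x - linv y) /\
  (linv x - linv y) (t - s - s) = - (x - y) t / x s ^+ 2.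
Proof.
move=> vx vy x0 exy vxy; have y0 : y s != 0 by rewrite -exy.
have -> : linv x - linv y = - ((x - y) * linv x * linv y).
  transitivity (linv x * (y * linv y) - (x * linv x) * linv y).
    by rewrite (mulx_linv vx x0) (mulx_linv vy y0) mulr1 mul1r.
  ring.
have vxyi := vanishes_belowM vxy (linv_vanishes vx x0).
split.
  exact/vanishes_belowN/(vanishes_belowM vxyi (linv_vanishes vy y0)).
rewrite lcoefN (lcoefM_lead vxyi (linv_vanishes vy y0)).
rewrite (lcoefM_lead vxy (linv_vanishes vx x0)) !linv_lead// -exy.
by rewrite expr2; field.
Qed.

(** * Integer powers and composition with a series of order 1 *)

Definition lexp x (k : int) : laurent K :=
  match k with Posz m => x ^+ m | Negz m => linv x ^+ m.+1 end.

Lemma laurent_expE x k : laurent_exp x k = lexp x k.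
Proof.
have iterE y (u : int -> K) m :
    u = y -> iter m (laurent_mul u) (laurent_one K) = y ^+ m.
  by move=> ->; elim: m => [|m IHm]; rewrite ?expr0// iterS IHm exprS.
by case: k => m; exact: iterE.
Qed.

Section OrderOne.
Variables (x : laurent K).
Hypotheses (vx : vanishes_below 1 x) (x10 : x 1 != 0).

Lemma lexp_vanishes k : vanishes_below k (lexp x k).
Proof.
case: k => k.
  rewrite /= (_ : Posz k = 1 *+ k); first exact: vanishes_belowX.
  by rewrite -mulr_natr mul1r natz.
rewrite /= NegzE (_ : - _ = (- 1) *+ k.+1).
  exact/vanishes_belowX/linv_vanishes.
by rewrite mulNrn -[1 *+ _]mulr_natr mul1r natz.
Qed.

Lemma lexpN_lead k : lexp x (- k%:Z) (- k%:Z) = (x 1)^-1 ^+ k.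
Proof.
case: k => [|k]; first by rewrite expr0; exact: (lcoef1 _ 0).
rewrite -NegzE /= NegzE (_ : - _ = (- 1) *+ k.+1).
  by rewrite lcoefX_lead ?linv_lead//; exact: linv_vanishes.
by rewrite mulNrn -[1 *+ _]mulr_natr mul1r natz.
Qed.

(** Since [lexp x k] has order at least [k], only the indices [s <= k <= n] contribute. *)
Lemma laurent_compE (g : int -> K) s n L :
  vanishes_below s g -> n < s + L%:Z ->
  laurent_comp g x n = \sum_(k <- int_range s L) g k * lexp x k n.
Proof.
move=> vg nL; rewrite /laurent_comp.
rewrite (@fsbig_int_range _ _ s L) => [|k kN].
  by apply: eq_bigr => k _; rewrite laurent_expE.
rewrite laurent_expE; have [ks|ks] := ltP k s; first by rewrite vg ?mul0r.
by rewrite (lexp_vanishes (k := k)) ?mulr0//; lia.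
Qed.

Lemma laurent_comp_vanishes (g : int -> K) s :
  vanishes_below s g -> vanishes_below s (laurent_comp g x).
Proof.
by move=> vg n ns; rewrite (laurent_compE (L := 0) vg) ?big_nil//; lia.
Qed.

Lemma laurent_comp_lead (g : int -> K) s :
  vanishes_below s g -> laurent_comp g x s = g s * lexp x s s.
Proof.
move=> vg; rewrite (laurent_compE (L := 1) vg); last lia.
by rewrite big_seq1 addr0.
Qed.

End OrderOne.

(** To first order the difference is [k x^(k-1) (x - y)], of order at least [n + k - 1]. Negative
    exponents are treated as powers of [linv x], which has order -1. *)
Lemma lexpB x y k n : vanishes_below 1 x -> vanishes_below 1 y ->
  x 1 != 0 -> x 1 = y 1 -> vanishes_below n (x - y) ->
  vanishes_below (n - 1 + k) (lexp x k - lexp y k).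
Proof.
move=> vx vy x0 exy vxy; have y0 : y 1 != 0 by rewrite -exy.
case: k => k.
  case: k => [|k]; first by move=> m _; exact: (subrr ((1 : laurent K) m)).
  rewrite (_ : _ - 1 + _ = n + 1 *+ k); first exact: subX_vanishes.
  by rewrite -mulr_natr mul1r natz; lia.
have [vi _] := linvB vx vy x0 exy vxy.
rewrite (_ : n - 1 + _ = n - 1 - 1 + (- 1) *+ k).
  exact: (subX_vanishes (linv_vanishes vx x0) (linv_vanishes vy y0)).
by rewrite mulNrn -[1 *+ _]mulr_natr mul1r natz NegzE; lia.
Qed.

Lemma lexpBN_lead x y k n : vanishes_below 1 x -> vanishes_below 1 y ->
  x 1 != 0 -> x 1 = y 1 -> vanishes_below n (x - y) ->
  (lexp x (- k%:Z) - lexp y (- k%:Z)) (n - 1 - k%:Z) =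
  - k%:R * (x 1)^-1 ^+ k.+1 * (x - y) n.
Proof.
move=> vx vy x0 exy vxy; have y0 : y 1 != 0 by rewrite -exy.
case: k => [|k].
  rewrite [0%:R]mulr0n [- 0 :> K]oppr0 !mul0r.
  exact: (subrr ((1 : laurent K) _)).
have [vi li] := linvB vx vy x0 exy vxy.
rewrite -NegzE (_ : n - 1 + _ = n - 1 - 1 + (- 1) *+ k); last first.
  by rewrite mulNrn -[1 *+ _]mulr_natr mul1r natz NegzE; lia.
etransitivity.
  apply: (subX_lead k (linv_vanishes vx x0) (linv_vanishes vy y0) vi).
  by rewrite !linv_lead// exy.
rewrite li linv_lead// !exprS -!natr1 expr0.
set i := (x 1)^-1.
rewrite (_ : _ / (x 1 * (x 1 * 1)) = - (x - y) n * (i * i)); last first.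
  by rewrite mulr1 invfM.
ring.
Qed.

End LaurentField.

(** * Formal derivatives and residues *)

Section Derivative.
Variable K : fieldType.
Implicit Types (x y z : laurent K) (s t n : int).

Fact is_laurent_deriv x : is_laurent (laurent_deriv x).
Proof.
have [s xs] := laurent_coefP x; exists (s - 1) => n ns.
by rewrite /laurent_deriv xs ?mulr0//; lia.
Qed.
Definition lderiv x := Laurent (is_laurent_deriv x).

Lemma lderivE x n : lderiv x n = (n + 1)%:~R * x (n + 1).
Proof. by []. Qed.

Lemma lderivB x y : lderiv (x - y) = lderiv x - lderiv y.
Proof. by apply: laurentP => n; rewrite lcoefB !lderivE lcoefB mulrBr. Qed.

Lemma lderiv1 : lderiv 1 = 0 :> laurent K.
Proof.
apply: laurentP => n; rewrite lderivE lcoef1 lcoef0.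
by case: eqP => [->|_]; rewrite ?mul0r ?mulr0.
Qed.

(** In the coefficient at [n] the factor [n + 1] splits as [k + (n + 1 - k)]. The sum for
    [lderiv x * y] is reindexed by [k - 1] so that all three sums run over the same products
    [x k * y (n + 1 - k)]. *)
Lemma lderivM x y : lderiv (x * y) = lderiv x * y + x * lderiv y.
Proof.
apply: laurentP => n; rewrite lcoefD lderivE.
have [s [vx vy _]] := laurent_vanishes x y y.
pose L := absz (Num.max 0 (n + 1 - s - s + 1)).
have nL : n + 1 - s < s + L%:Z by rewrite /L; lia.
have mulE (z z' : laurent K) : laurent_coef (z * z') = laurent_mul z z' by [].
rewrite !mulE (laurent_mulE vx vy (lexx s) nL) {1}/laurent_mul.
rewrite (reindex_fsbigT (fun k => k - 1)) /=; last first.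
  by exists (fun k => k + 1) => k; lia.
rewrite (@fsbig_int_range _ _ s L) => [|k kN]; last first.
  rewrite /laurent_deriv subrK; have [ks|ks] := ltP k s.
    by rewrite vx ?mulr0 ?mul0r.
  by rewrite (vy (n - (k - 1))) ?mulr0//; lia.
rewrite /laurent_mul (@fsbig_int_range _ _ s L) => [|k kN]; last first.
  have [ks|ks] := ltP k s; first by rewrite vx ?mul0r.
  by rewrite /laurent_deriv (vy (n - k + 1)) ?mulr0//; lia.
rewrite mulr_sumr -big_split /=; apply: eq_bigr => k _.
rewrite ?lderivE /laurent_deriv subrK (_ : n - (k - 1) = n + 1 - k); last lia.
rewrite (_ : n - k + 1 = n + 1 - k); last lia.
rewrite -{1}(subrK k (n + 1)) intrD; ring.
Qed.

Lemma lderivX x k : lderiv (x ^+ k.+1) = k.+1%:R * x ^+ k * lderiv x.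
Proof.
elim: k => [|k IHk]; first by rewrite expr1 expr0 !mul1r.
by rewrite exprS lderivM IHk exprS -(natr1 k.+1); ring.
Qed.

Lemma lderiv_vanishes x s :
  vanishes_below s x -> vanishes_below (s - 1) (lderiv x).
Proof. by move=> vx n ns; rewrite lderivE vx ?mulr0//; lia. Qed.

Lemma lderiv_linv x s : vanishes_below s x -> x s != 0 ->
  lderiv (linv x) = - lderiv x * linv x ^+ 2.
Proof.
move=> vx xs0; have xi := mulx_linv vx xs0.
have /eqP : lderiv (x * linv x) = 0 by rewrite xi lderiv1.
rewrite lderivM => /eqP d0.
transitivity (linv x * (lderiv x * linv x + x * lderiv (linv x))
  - lderiv x * linv x ^+ 2 + (1 - x * linv x) * lderiv (linv x)); first by ring.
by rewrite d0 xi; ring.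
Qed.

Section OrderOne.
Variable x : laurent K.
Hypotheses (vx : vanishes_below 1 x) (x10 : x 1 != 0).

Lemma lderiv_vanishes0 : vanishes_below 0 (lderiv x).
Proof. exact: (lderiv_vanishes vx). Qed.

Lemma lderiv_lead0 : lderiv x 0 = x 1.
Proof. by rewrite lderivE add0r mul1r. Qed.

(* The residue of [x' x^k] is that of [dX / X] for [k = - 1]; otherwise
   [(k + 1) x' x^k] is the derivative of [x^(k + 1)]. *)
Lemma residue_lexp k : [pchar K] =i pred0 ->
  (lderiv x * lexp x (Negz k)) (- 1) = (k == 0)%:R.
Proof.
move=> charK; have vi := linv_vanishes vx x10.
case: k => [|k].
  rewrite /lexp expr1 -[- 1]add0r (lcoefM_lead lderiv_vanishes0 vi).
  by rewrite lderiv_lead0 (linv_lead vx x10) mulfV.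
(* [Negz k.+1] is the exponent -(k + 2), so x' x^(-k-2) is the derivative of x^(-k-1) up to the
   factor -(k + 1). A derivative has no term in X^(-1), and in characteristic 0 the factor can be
   cancelled. *)
have : lderiv (linv x ^+ k.+1) (- 1) = 0 by rewrite lderivE addNr mul0r.
rewrite lderivX (lderiv_linv vx x10).
rewrite (_ : k.+1%:R * _ * _ = - (k.+1%:R * (lderiv x * lexp x (Negz k.+1))));
  last first.
  by rewrite /lexp -[in RHS]addn2 exprD; ring.
rewrite lcoefN mulr_natl => /eqP; rewrite oppr_eq0 => /eqP.
have coefMn (y : laurent K) m n : (y *+ m) n = y n *+ m.
  by elim: m => [|m IHm]; rewrite ?mulr0n// !mulrS lcoefD IHm.
rewrite coefMn -[LHS]mulr_natr => /eqP; rewrite mulf_eq0 => /orP[/eqP->//|].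
by rewrite (pcharf0P K).1.
Qed.

(** By linearity the residue is the sum of the [g k] times the residues of x' x^k, of which only
    that for k = -1 is nonzero. As x' has no polar part, only the indices from [- d] to -1 come
    in. *)
Lemma residue_pullback (g : int -> K) (d : nat) : [pchar K] =i pred0 ->
  vanishes_below (- d%:Z) g -> (0 < d)%N ->
  laurent_mul (lderiv x) (laurent_comp g x) (- 1) = g (- 1).
Proof.
move=> charK vg d0.
have vc := laurent_comp_vanishes vx x10 vg.
pose r := int_range (- d%:Z) d.
transitivity (\sum_(j <- int_range 0 d) \sum_(k <- r)
    lderiv x j * (g k * lexp x k (- 1 - j))).
  rewrite (laurent_mulE (L := d) lderiv_vanishes0 vc (lexx 0)); last lia.
  apply: eq_big_seq => j; rewrite mem_int_range => jd.
  by rewrite -mulr_sumr (laurent_compE (L := d) vx x10 vg)//; lia.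
rewrite exchange_big /=.
transitivity (\sum_(k <- r) g k * (k == - 1)%:R).
  apply: eq_big_seq => k; rewrite mem_int_range => kd.
  have [m kE md] : exists2 m, k = Negz m & (m < d)%N.
    by exists (absz (k + 1)); lia.
  have -> : (k == - 1) = (m == 0%N) by rewrite kE; lia.
  rewrite -residue_lexp// -kE.
  have lM : (lderiv x * lexp x k) (- 1) =
    laurent_mul (lderiv x) (lexp x k) (- 1) by [].
  have vk := lexp_vanishes vx x10 (k := k).
  rewrite lM (laurent_mulE (L := d) lderiv_vanishes0 vk (lexx 0)); last lia.
  by rewrite mulr_sumr; apply: eq_bigr => j _; rewrite mulrCA.
rewrite (bigD1_seq (- 1)) ?int_range_uniq//=; last by rewrite mem_int_range; lia.
rewrite mulr1 big1 ?addr0// => k /negbTE->; exact: mulr0.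
Qed.

End OrderOne.
End Derivative.

(** * How the pullback depends on the coefficients of the change of variable *)

Section Pullback.
Variables (K : fieldType) (d : nat) (g : int -> K).
Hypotheses (d2 : (2 <= d)%N) (vg : vanishes_below (- d%:Z) g).
Implicit Types x y : laurent K.

(** [formal_pullback] read on bundled series, so that derivatives and inverses are elements of the
    ring. *)
Definition lpullback x : int -> K :=
  laurent_add (laurent_mul (lderiv x) (laurent_comp g x))
    (laurent_mul (lderiv (lderiv x)) (linv (lderiv x))).

Section OrderOne.
Variable x : laurent K.
Hypotheses (vx : vanishes_below 1 x) (x10 : x 1 != 0).

Fact is_laurent_pullback_comp : is_laurent (laurent_comp g x).
Proof. by exists (- d%:Z); exact: laurent_comp_vanishes. Qed.

(** The series x'' is a derivative, hence has no term in X^(-1), and x' is invertible as a power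
    series. So x''/x' does not affect the polar part of the pullback. *)
Lemma lderiv2_linv_vanishes :
  vanishes_below 0 (lderiv (lderiv x) * linv (lderiv x)).
Proof.
have dx0 : lderiv x 0 != 0 by rewrite lderiv_lead0.
rewrite -[0]addr0; apply: vanishes_belowM.
  move=> n; rewrite lderivE; have [-> _|n1 n0] := eqVneq n (- 1).
    by rewrite addNr mul0r.
  by rewrite (lderiv_vanishes0 vx) ?mulr0//; lia.
by rewrite -oppr0; exact: (linv_vanishes (lderiv_vanishes0 vx)).
Qed.

Lemma lpullback_polar n : n < 0 ->
  lpullback x n = laurent_mul (lderiv x) (laurent_comp g x) n.
Proof.
move=> n0; rewrite /lpullback /laurent_add.
by rewrite [X in _ + X]lderiv2_linv_vanishes// addr0.
Qed.

Lemma lpullback_vanishes : vanishes_below (- d%:Z) (lpullback x).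
Proof.
move=> n nd; rewrite lpullback_polar; last lia.
apply: (laurent_mul_vanishes (lderiv_vanishes0 vx)
  (laurent_comp_vanishes vx x10 vg)); lia.
Qed.

Lemma lpullback_lead :
  lpullback x (- d%:Z) = x 1 * (g (- d%:Z) * (x 1)^-1 ^+ d).
Proof.
rewrite lpullback_polar; last lia.
rewrite -[- d%:Z]add0r (laurent_mul_lead (lderiv_vanishes0 vx)
  (laurent_comp_vanishes vx x10 vg)) lderiv_lead0 add0r.
by rewrite (laurent_comp_lead vx x10 vg) lexpN_lead.
Qed.

Lemma lpullback_residue : [pchar K] =i pred0 -> lpullback x (- 1) = g (- 1).
Proof.
move=> charK; rewrite lpullback_polar// (residue_pullback vx x10 charK vg)//.
lia.
Qed.

End OrderOne.

(** The term of [g] at [i] contributes a difference of order at least [n - 1 + i], so at index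
    [n - 1 - d] only [i = - d] is felt. *)
Lemma laurent_compB x y (n : int) :
    0 < n -> vanishes_below 1 x -> vanishes_below 1 y ->
    x 1 != 0 -> x 1 = y 1 -> vanishes_below n (x - y) ->
  (forall k, k < n - 1 - d%:Z -> laurent_comp g x k = laurent_comp g y k) /\
  laurent_comp g x (n - 1 - d%:Z) - laurent_comp g y (n - 1 - d%:Z) =
    - d%:R * g (- d%:Z) * (x 1)^-1 ^+ d.+1 * (x - y) n.
Proof.
move=> n0 vx vy x0 exy vxy; have y0 : y 1 != 0 by rewrite -exy.
have compB k L : k < - d%:Z + L%:Z ->
    laurent_comp g x k - laurent_comp g y k =
    \sum_(i <- int_range (- d%:Z) L) g i * (lexp x i - lexp y i) k.
  move=> kL; rewrite (laurent_compE vx x0 vg kL) (laurent_compE vy y0 vg kL).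
  by rewrite -sumrB; apply: eq_bigr => i _; rewrite lcoefB mulrBr.
pose L k := absz (Num.max 0 (k + d%:Z + 1)).
have kL k : k < - d%:Z + (L k)%:Z by rewrite /L; lia.
split=> [k kn|].
  apply/eqP; rewrite -subr_eq0 (compB _ _ (kL k)) big1_seq// => i.
  rewrite mem_int_range => id; rewrite (lexpB vx vy x0 exy vxy) ?mulr0//; lia.
rewrite (compB _ _ (kL _)).
rewrite (bigD1_seq (- d%:Z)) ?int_range_uniq//; last first.
  by rewrite mem_int_range; have := kL (n - 1 - d%:Z); lia.
rewrite (lexpBN_lead d vx vy x0 exy vxy) big1_seq.
  by rewrite [LHS]addr0; ring.
move=> i; rewrite mem_int_range => iL.
by rewrite (lexpB vx vy x0 exy vxy) ?mulr0//; lia.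
Qed.

(** The factor [n - d] collects [n] from the variation of x' and [- d] from that of the composition.
    The variation of x''/x' has order at least [n - 2], beyond [n - 1 - d] since [d >= 2]. *)
Lemma lpullbackB x y (n : int) :
    2 <= n -> vanishes_below 1 x -> vanishes_below 1 y ->
    x 1 != 0 -> x 1 = y 1 -> vanishes_below n (x - y) ->
  (forall k, k < n - 1 - d%:Z -> lpullback x k = lpullback y k) /\
  lpullback x (n - 1 - d%:Z) - lpullback y (n - 1 - d%:Z) =
    (n - d%:Z)%:~R * g (- d%:Z) * (x 1)^-1 ^+ d * (x - y) n.
Proof.
move=> n2 vx vy x0 exy vxy; have y0 : y 1 != 0 by rewrite -exy.
pose Gx := Laurent (is_laurent_pullback_comp vx x0).
pose Gy := Laurent (is_laurent_pullback_comp vy y0).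
have [compB0 compB1] := laurent_compB (ltac:(lia) : 0 < n) vx vy x0 exy vxy.
have vGxy : vanishes_below (n - 1 - d%:Z) (Gx - Gy).
  by move=> k kn; rewrite lcoefB /= compB0// subrr.
have vGy : vanishes_below (- d%:Z) Gy by exact: laurent_comp_vanishes.
have vdx := lderiv_vanishes0 vx; have vdy := lderiv_vanishes0 vy.
have vdxy : vanishes_below (n - 1) (lderiv x - lderiv y).
  by rewrite -lderivB; exact: lderiv_vanishes.
have vddxy : vanishes_below (n - 1 - 1) (lderiv (lderiv x) - lderiv (lderiv y)).
  by rewrite -lderivB; exact: lderiv_vanishes.
have dx0 : lderiv x 0 != 0 by rewrite lderiv_lead0.
have dexy : lderiv x 0 = lderiv y 0 by rewrite !lderiv_lead0.
have [vixy _] := linvB vdx vdy dx0 dexy vdxy.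
have vix := linv_vanishes vdx dx0.
have pB k : lpullback x k - lpullback y k =
    (lderiv x * (Gx - Gy)) k + ((lderiv x - lderiv y) * Gy) k
    + ((lderiv (lderiv x) - lderiv (lderiv y)) * linv (lderiv x)) k
    + (lderiv (lderiv y) * (linv (lderiv x) - linv (lderiv y))) k.
  (* The pullback is regrouped as a coefficient of one ring element, so that [ring] can expand the
     difference. *)
  have E z w :
      lpullback z k = (lderiv z * w) k + (lderiv (lderiv z) * linv (lderiv z)) k ->
    lpullback z k = (lderiv z * w + lderiv (lderiv z) * linv (lderiv z)) k by [].
  rewrite (E x Gx)// (E y Gy)// -!lcoefD -lcoefB; congr (laurent_coef _ k); ring.
have v3 := vanishes_belowM vddxy vix.
have v4 := vanishes_belowM (lderiv_vanishes vdy) vixy.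
have v1 := vanishes_belowM vdx vGxy.
have v2 := vanishes_belowM vdxy vGy.
split=> [k kn|].
  apply/eqP; rewrite -subr_eq0 pB v1 ?v2 ?v3 ?v4 ?addr0//; lia.
rewrite pB v3 ?v4 ?addr0; [|lia|lia].
rewrite -{1}[n - 1 - d%:Z]add0r (lcoefM_lead vdx vGxy) (lcoefM_lead vdxy vGy).
rewrite [(Gx - Gy) _]compB1 lderiv_lead0.
rewrite (_ : (lderiv x - lderiv y) (n - 1) = n%:~R * (x - y) n); last first.
  by rewrite -lderivB lderivE subrK.
rewrite [Gy _](laurent_comp_lead vy y0 vg) lexpN_lead// -exy.
rewrite intrD rmorphN /= exprS.
by field.
Qed.

End Pullback.

(** * Solving for the formal change of variable *)

(** The series is sought as [a X] plus terms of index at least 2. The coefficient [a] is a datum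
    because it is a root of degree [d - 1], which [K] need not contain. *)
Lemma formally_equivalent_irregular (K : fieldType) (d : nat) (a : K)
    (g1 g2 : int -> K) :
  [pchar K] =i pred0 -> (2 <= d)%N ->
  vanishes_below (- d%:Z) g1 -> vanishes_below (- d%:Z) g2 ->
  g2 (- d%:Z) != 0 -> g1 (- 1) = g2 (- 1) ->
  a != 0 -> a ^+ d.-1 * g1 (- d%:Z) = g2 (- d%:Z) ->
  formally_equivalent g1 g2.
Proof.
move=> charK d2 vg1 vg2 g20 res12 a0 lead12.
pose x0 := lmonomial a 1.
have adm x : vanishes_below 2 (x - x0) -> vanishes_below 1 x /\ x 1 = a.
  move=> vx; split=> [n n1|].
    have : (x - x0) n = 0 by apply: vx; lia.
    by rewrite lcoefB /= (_ : n == 1 = false) ?subr0//; lia.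
  by have : (x - x0) 1 = 0 by [apply: vx]; rewrite lcoefB /= => /subr0_eq.
have adm0 : vanishes_below 2 (x0 - x0) by move=> n _; rewrite subrr.
have [x /adm[vx x1] xg] : exists2 x, vanishes_below 2 (x - x0) &
    lpullback g2 x = g1.
  (* The unknown coefficient at [n] governs the pullback at [n - 1 - d], whence the shift
     [- 1 - d]. *)
  apply: (@triangular_solve _ _ x0 g1 2 (- 1 - d%:Z)
    (fun n => (n - d%:Z)%:~R * g2 (- d%:Z) * a^-1 ^+ d)).
  - move=> x y n n2 /adm[vx xa] /adm[vy ya] vxy; rewrite addrA -xa.
    by apply: lpullbackB => //; rewrite xa ?ya.
  - move=> x n n2 /adm[vx xa] /eqP; rewrite !mulf_eq0 (negbTE g20) orbF.
    rewrite expf_eq0 invr_eq0 (negbTE a0) andbF orbF => nd.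
    (* In characteristic 0 the diagonal entry vanishes only for [n = d]; the index concerned is then
       -1, where the residues agree. *)
    have -> : n = d%:Z.
      apply/eqP; rewrite -subr_eq0; move: nd; case: (n - d%:Z) => m.
        by rewrite -[_%:~R]/(m%:R) (pcharf0P K).1// => /eqP->.
      by rewrite NegzE rmorphN oppr_eq0 /= -[_%:~R]/(m.+1%:R) (pcharf0P K).1.
    rewrite addrCA subrr addr0 res12.
    by apply: (lpullback_residue d2 vg2 vx) => //; rewrite xa.
  (* The start [a X] already gives [g1] below [1 - d]: both sides vanish below [- d], and at [- d]
     this is the equation on [a]. *)
  - have [vx xa] := adm _ adm0; have xa0 : x0 1 != 0 by rewrite xa.
    move=> k kd; have [kd'|kd'] := ltP k (- d%:Z).
      by rewrite vg1// (lpullback_vanishes d2 vg2 vx).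
    have -> : k = - d%:Z by lia.
    rewrite (lpullback_lead d2 vg2 vx xa0) xa -lead12.
    have aE : a ^+ d = a * a ^+ d.-1 by rewrite -exprS prednK//; lia.
    by rewrite exprVn aE; field; rewrite expf_neq0.
exists (fun n => x n%:Z); split; first exact: vx; first by rewrite x1.
have xE : laurent_of_series (fun n => x n%:Z) = x.
  by apply/funext => -[m|m] //=; rewrite vx.
by rewrite /formal_pullback xE -xg.
Qed.

(** * Uniqueness of Laurent expansions *)

Section Expansions.
Local Open Scope classical_set_scope.

(** If [a m] is the first nonzero coefficient, then close enough to [p] its term dominates a
    geometric bound on all later ones, so the partial sums stay away from 0. *)
Lemma power_series_eq0 (K : numFieldType) (p : K^o) (a : nat -> K) :
  (\forall z \near p^',
    series (fun k => a k * (z - p) ^+ k : K^o) @ \oo --> (0 : K^o)) ->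
  forall k, a k = 0.
Proof.
move=> /nbhs_ballP[e /= e0 pe].
have cvgS (t : K) : 0 < t -> t < e ->
    series (fun k => a k * t ^+ k : K^o) @ \oo --> (0 : K^o).
  move=> t0 te; have := pe (p + t); rewrite (addrC p t) addrK; apply.
    by rewrite -ball_normE /= opprD addrCA subrr addr0 normrN gtr0_norm.
  by rewrite -subr_eq0 addrK gt_eqF.
pose r := e / 2; have r0 : 0 < r by rewrite divr_gt0.
have re : r < e by rewrite ltr_pdivrMr// ltr_pMr// ltr1n.
clearbody r.
have [M M0 aM] : exists2 M : K, 0 < M & forall k, `|a k * r ^+ k| <= M.
  have /cvgP/cvg_series_cvg_0/cvgP/cvg_seq_bounded := cvgS r r0 re.
  by move=> /ex_strict_bound_gt0[M M0 aM]; exists M => // k; apply/ltW/aM.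
elim/ltn_ind => m IHm; apply/eqP; apply/negP => /negP am0.
pose c := `|a m|; have c0 : 0 < c by rewrite normr_gt0.
(* The tail will be bounded by [2 M q^(m+1)], which equals [C t^(m+1)]; hence the need for
   [t * C < c]. The value of [t] below meets both this and [t < r / 2]. *)
pose C := 2 * M / r ^+ m.+1.
have C0 : 0 < C by apply: divr_gt0; [exact: mulr_gt0|exact: exprn_gt0].
have cC0 : 0 < c + C * r.
  by apply: addr_gt0 => //; exact: mulr_gt0.
pose t := r / 2 * (c / (c + C * r)).
have t0 : 0 < t by rewrite !mulr_gt0 ?invr_gt0.
have tr : t < r / 2.
  rewrite /t -[ltRHS]mulr1 ltr_pM2l ?divr_gt0// ltr_pdivrMr// mul1r ltrDl.
  exact: mulr_gt0.
have tC : t * C < c.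
  have -> : t * C = c * (C * r) / (2 * (c + C * r)).
    by rewrite /t; field; rewrite gt_eqF.
  rewrite ltr_pdivrMr ?mulr_gt0// ltr_pM2l//.
  rewrite (_ : 2 * _ = C * r + (c + (c + C * r))); last by ring.
  by rewrite ltrDl addr_gt0.
clearbody t.
pose q := t / r; have q0 : 0 < q by rewrite divr_gt0.
have q2 : 2 * q <= 1.
  by rewrite /q mulrCA mulrA ler_pdivrMr// mul1r -ler_pdivlMr// ltW.
have term k : `|a k * t ^+ k| <= M * q ^+ k.
  rewrite (_ : a k * t ^+ k = a k * r ^+ k * q ^+ k); last first.
    by rewrite -mulrA -exprMn /q mulrCA mulfV ?mulr1// gt_eqF.
  by rewrite normrM (gtr0_norm (exprn_gt0 k q0)) ler_pM2r ?exprn_gt0.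
pose S := series (fun k => a k * t ^+ k : K^o).
(* The bound telescopes: [M q^i <= 2 M (q^i - q^(i+1))] because [2 q <= 1]. *)
have tail j : `|S (m.+1 + j)%N - a m * t ^+ m| <=
    2 * M * (q ^+ m.+1 - q ^+ (m.+1 + j)).
  elim: j => [|j IHj].
    rewrite addn0 subrr mulr0 /S seriesEnat /= big_nat_recr//= big_nat.
    rewrite big1 ?add0r ?subrr ?normr0// => i im.
    by rewrite IHm// mul0r.
  rewrite addnS /S seriesSr -/S addrAC.
  apply: (le_trans (ler_normD _ _)); apply: (le_trans (lerD IHj (term _))).
  rewrite -subr_ge0 (exprS q (m.+1 + j)).
  set u := q ^+ (m.+1 + j).
  have u0 : 0 < u by exact: exprn_gt0.
  rewrite (_ : _ - _ = M * u * (1 - 2 * q)); last by ring.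
  by rewrite mulr_ge0 ?subr_ge0// ltW// mulr_gt0.
have gap : 0 < c * t ^+ m - 2 * M * q ^+ m.+1.
  rewrite (_ : _ - _ = t ^+ m * (c - t * C)); last first.
    rewrite /q /C exprMn exprVn (exprS t) (exprS r).
    by field; rewrite ?expf_neq0 ?gt_eqF.
  by rewrite mulr_gt0 ?exprn_gt0 ?subr_gt0.
have tre : t < e.
  apply: (lt_trans tr); apply: lt_trans re.
  by rewrite ltr_pdivrMr// ltr_pMr// ltr1n.
have /cvgr0Pnorm_lt/(_ _ gap)[N _ SN] := cvgS t t0 tre.
have := SN (m.+1 + N)%N (leq_addl _ _); rewrite -/S => SNgap.
suff : c * t ^+ m < c * t ^+ m by rewrite ltxx.
rewrite {1}(_ : c * t ^+ m = `|S (m.+1 + N)%N - (S (m.+1 + N)%N - a m * t ^+ m)|);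
  last by rewrite opprB addrCA subrr addr0 normrM (gtr0_norm (exprn_gt0 m t0)).
apply: (le_lt_trans (ler_normB _ _)).
apply: (lt_le_trans (ltr_leD SNgap (tail N))).
rewrite -subr_ge0 (_ : _ - _ = 2 * M * q ^+ (m.+1 + N)); last by ring.
by apply/ltW/mulr_gt0; [exact: mulr_gt0|exact: exprn_gt0].
Qed.

(** Both expansions are padded to start at the same index [- M]; their difference times [(z - p)^M]
    is then a power series with sum 0. *)
Lemma laurent_expansion_unique (R : realType) (f : Cplane R -> Cplane R)
    (p : Cplane R) (c c' : int -> R[i]) :
  laurent_expansion f p c -> laurent_expansion f p c' -> c = c'.
Proof.
move=> [N [cN fc]] [N' [cN' fc']].
(* Starting the series [l] indices earlier only prepends zero terms, which shifts the partial sums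
   by [l]. *)
have shift (b : int -> R[i]) (m l : nat) z :
    (forall n : int, n < - (m%:Z) -> b n = 0) ->
    series (fun k : nat => (b (k%:Z - m%:Z) * (z - p) ^ (k%:Z - m%:Z)) : Cplane R)
      @ \oo --> f z ->
    series (fun k : nat => (b (k%:Z - (l + m)%:Z) *
      (z - p) ^ (k%:Z - (l + m)%:Z)) : Cplane R) @ \oo --> f z.
  move=> bm; set u := (fun k : nat => _) => uf; set v := (fun k : nat => _).
  rewrite -(cvg_shiftn l).
  suff -> : [sequence series v (n + l)%N]_n = series u by [].
  apply/funext => n /=; rewrite !seriesEnat /= (big_cat_nat _ (leq_addl n l))//=.
  rewrite big_nat big1 => [|k kl]; last by rewrite /v bm ?mul0r//; lia.
  rewrite add0r -{1}[l]add0n big_addn addnK.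
  by apply: eq_bigr => k _; rewrite /u /v; congr (b _ * _ ^ _); lia.
pose M := (N + N')%N.
have e0 k : c (k%:Z - M%:Z) - c' (k%:Z - M%:Z) = 0.
  apply: (@power_series_eq0 R[i] p (fun k => c (k%:Z - M%:Z) - c' (k%:Z - M%:Z))).
  near=> z.
  have zp : z != p by near: z; exact: nbhs_dnbhs_neq.
  have /(shift _ _ N') uf :
      series (fun k : nat => (c (k%:Z - N%:Z) * (z - p) ^ (k%:Z - N%:Z))
    : Cplane R) @ \oo --> f z by near: z.
  have /(shift _ _ N) uf' :
      series (fun k : nat => (c' (k%:Z - N'%:Z) * (z - p) ^ (k%:Z - N'%:Z))
    : Cplane R) @ \oo --> f z by near: z.
  have := cvgM (cvgB (uf cN) (uf' cN')) (cvg_cst ((z - p) ^+ M : Cplane R)).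
  rewrite subrr mul0r => /(_ _ _ _) lim0; apply: cvg_trans lim0.
  apply: near_eq_cvg; apply: nearW => n /=.
  rewrite !seriesEnat /= !fctE /= -sumrB mulr_suml; apply: eq_bigr => i _.
  rewrite (addnC N') -/M -mulrBl -mulrA; congr (_ * _).
  by rewrite !exprnP -expfzDr ?subr_eq0// subrK.
apply: funext => n; have [nM|nM] := ltP n (- M%:Z).
  by rewrite cN ?cN'//; rewrite /M in nM; lia.
have -> : n = (absz (n + M%:Z))%:Z - M%:Z by lia.
exact/subr0_eq.
Unshelve. all: by end_near.
Qed.

Lemma laurent_expansionN (R : realType) (f : Cplane R -> Cplane R)
    (p : Cplane R) (c : int -> R[i]) :
  laurent_expansion f p c ->
  laurent_expansion (fun z => - f z) p (fun n => - c n).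
Proof.
move=> [N [cN fc]]; exists N; split=> [n /cN->|]; first by rewrite oppr0.
near=> z.
have : series (fun k : nat => (c (k%:Z - N%:Z) * (z - p) ^ (k%:Z - N%:Z))
    : Cplane R) @ \oo --> f z by near: z.
move=> /cvgN; apply: cvg_trans; apply: near_eq_cvg; apply: nearW => n.
rewrite !seriesEnat /= !fctE -sumrN; apply: eq_bigr => k _.
by rewrite mulNr.
Unshelve. all: by end_near.
Qed.

End Expansions.

(** * Passage from connections to formal series *)

(** Order and residue are each attested by an expansion of their own; uniqueness identifies the two,
    up to the sign in the convention for the residue. *)
Lemma connection_expansion (R : realType) (d : nat) (res : R[i])
    (X : riemannSurface R) (nabla : meromorphicConnection X) (p : X)
    (R1 : chart R X) :
  connection_pole nabla p d -> connection_residue nabla p res ->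
  riemann_chart R1 -> chart_dom R1 p ->
  exists c, [/\ laurent_expansion (christoffel nabla R1) (R1 p) c,
    c (- d%:Z) != 0, vanishes_below (- d%:Z) c & c (- 1) = - res].
Proof.
move=> pole res1 hR1 dom1.
have [_ [c [fc cd cv]]] := pole R1 hR1 dom1.
have [c' [fc' c'res]] := res1 R1 hR1 dom1.
exists c; split=> //.
have cc' := laurent_expansion_unique fc' (laurent_expansionN fc).
by rewrite -c'res cc' opprK.
Qed.

Theorem theorem1p1 (R : realType) (d : nat) (hd : (2 <= d)%N) (res : R[i])
    (X1 X2 : riemannSurface R)
    (nabla1 : meromorphicConnection X1) (nabla2 : meromorphicConnection X2)
    (p1 : X1) (p2 : X2)
    (pole1 : connection_pole nabla1 p1 d)
    (pole2 : connection_pole nabla2 p2 d)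
    (res1 : connection_residue nabla1 p1 res)
    (res2 : connection_residue nabla2 p2 res)
    (R1 : chart R X1) (R2 : chart R X2)
    (hR1 : riemann_chart R1) (hR2 : riemann_chart R2)
    (dom1 : chart_dom R1 p1) (dom2 : chart_dom R2 p2)
    (R1p1 : R1 p1 = 0) (R2p2 : R2 p2 = 0) :
  formally_equivalent_germs (christoffel nabla1 R1) (christoffel nabla2 R2).
Proof.
have [g1 [fg1 g1d vg1 g1res]] := connection_expansion pole1 res1 hR1 dom1.
have [g2 [fg2 g2d vg2 g2res]] := connection_expansion pole2 res2 hR2 dom2.
exists g1, g2; split; [by rewrite -R1p1|by rewrite -R2p2|].
(* Matching the coefficients at [- d] requires [a^(d-1) = g2 (- d) / g1 (- d)]; a complex root
   exists because [d - 1 > 0]. *)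
pose a : R[i] := d.-1.-root (g2 (- d%:Z) / g1 (- d%:Z)).
have aE : a ^+ d.-1 = g2 (- d%:Z) / g1 (- d%:Z) by apply: rootCK; lia.
have d1 : (0 < d.-1)%N by lia.
have a0 : a != 0.
  have : a ^+ d.-1 != 0 by rewrite aE mulf_neq0 ?invr_neq0.
  by rewrite expf_eq0 d1.
apply: (formally_equivalent_irregular (a := a) (pchar_num _) hd vg1 vg2) => //.
  by rewrite g1res g2res.
by rewrite aE mulfVK.
Qed.
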